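(* Let $0\le k\le n$ be integers and fix a derangement $\sigma\in D_k$. Let $\mathcal{A}$ be the set of standard labeled partitions $(\mu,\pi)$ with $\pi\in S_n$ and $dp(\pi)=\sigma$, and let $\mathcal{B}$ be the set of pairs $(\beta,\gamma)$ where $\beta=(\beta_1\ge\cdots\ge\beta_k\ge 0)$ and $\gamma=(\gamma_1\ge\cdots\ge\gamma_{n-k}\ge 0)$ are partitions with at most $k$ and at most $n-k$ parts respectively, such that $(\beta,\sigma)$ is a standard labeled partition. For $(\mu,\pi)\in\mathcal{A}$, let $i_1<\cdots<i_{n-k}$ be the fixed points of $\pi$ and $j_1<\cdots<j_k$ its derangement points, and set $$\varphi(\mu,\pi)=(\beta,\gamma),\qquad \beta=(\mu_{j_1},\mu_{j_2},\ldots,\mu_{j_k}),\quad \gamma=(\mu_{i_1},\mu_{i_2},\ldots,\mu_{i_{n-k}}).$$ Then $\varphi$ is a bijection from $\mathcal{A}$ to $\mathcal{B}$ (in particular $(\beta,\sigma)$ is a standard labeled partition for every $(\mu,\pi)\in\mathcal{A}$), and $|\mu|=|\beta|+|\gamma|$.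
   Context: $S_n$ is the set of permutations $\pi=\pi_1\pi_2\cdots\pi_n$ of $\{1,\ldots,n\}$. An index $i$ is a fixed point of $\pi$ if $\pi_i=i$ and a derangement point otherwise; $D_k$ is the set of permutations in $S_k$ with no fixed points. If the derangement points of $\pi$ are $p_1<\cdots<p_k$, then $dp(\pi)\in S_k$ is the permutation whose entries are in the same relative order as $\pi_{p_1},\pi_{p_2},\ldots,\pi_{p_k}$ (the standardization of this sequence); it lies in $D_k$. A partition with at most $m$ parts is a sequence $\lambda=(\lambda_1,\ldots,\lambda_m)$ of integers with $\lambda_1\ge\lambda_2\ge\cdots\ge\lambda_m\ge 0$, and $|\lambda|=\lambda_1+\cdots+\lambda_m$. A labeled partition is a pair $(\lambda,\pi)$ of a partition $\lambda$ with at most $m$ parts and a permutation $\pi\in S_m$; it is standard if for every $i$, $\pi_i>\pi_{i+1}$ implies $\lambda_i>\lambda_{i+1}$. *)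

(* Defs.v *)
From mathcomp Require Import classical_sets functions.
From mathcomp Require Import all_boot all_fingroup.

Set Implicit Arguments.
Unset Strict Implicit.
Unset Printing Implicit Defensive.

(* Indices and permutation values are 0-based: 'S_n permutes {0, ..., n-1}. *)

Definition fixed_points n (pi : 'S_n) : {set 'I_n} := [set i | pi i == i].

Definition derangement_points n (pi : 'S_n) : {set 'I_n} :=
  [set i | pi i != i].

Definition derangements k : {set 'S_k} := [set s : 'S_k | [forall i, s i != i]].

Section Standardization.
Variables (m : nat) (w : 'I_m -> nat).

Lemma std_subproof (i : 'I_m) : #|[pred j | w j < w i]| < m.
Proof.
rewrite -[X in _ < X]card_ord; apply: proper_card; apply/properP.
by split; [exact/subsetP | exists i; rewrite ?inE ?ltnn].
Qed.

Definition std_fun (i : 'I_m) : 'I_m := Ordinal (std_subproof i).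

Lemma std_fun_mono (i j : 'I_m) : w i < w j -> std_fun i < std_fun j.
Proof.
move=> lt_ij; apply: proper_card; apply/properP; split.
  by apply/subsetP=> l; rewrite !inE => /ltn_trans; apply.
by exists i; rewrite !inE ?ltnn.
Qed.

Hypothesis w_inj : injective w.

Lemma std_fun_inj : injective std_fun.
Proof.
move=> i j eq_ij; apply: w_inj.
by case: (ltngtP (w i) (w j)) => // /std_fun_mono; rewrite eq_ij ltnn.
Qed.

Definition std : 'S_m := perm std_fun_inj.

Lemma std_ltn (i j : 'I_m) : (std i < std j) = (w i < w j).
Proof.
rewrite !permE; case: (ltngtP (w i) (w j)) => [/std_fun_mono-> //|lt_ji|/w_inj->].
  by apply/negbTE; rewrite -leqNgt ltnW // std_fun_mono.
exact: ltnn.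
Qed.

End Standardization.

(* enum_val lists the elements of a subset of 'I_n in increasing order, so this
   is the word pi_{p_1} ... pi_{p_k} at the derangement points p_1 < ... < p_k *)
Definition derangement_word n (pi : 'S_n) (i : 'I_#|derangement_points pi|) :
  nat := pi (enum_val i).

Lemma derangement_word_inj n (pi : 'S_n) : injective (derangement_word (pi := pi)).
Proof. by move=> i j /val_inj/perm_inj/enum_val_inj. Qed.

Definition dp n (pi : 'S_n) : 'S_#|derangement_points pi| :=
  std (derangement_word_inj (pi := pi)).

(* A partition with at most m parts is padded with zeros to length exactly m. *)
Definition is_partition m (lambda : seq nat) : bool :=
  (size lambda == m) && sorted geq lambda.

Definition standard_labeled_partition m (lambda : seq nat) (pi : 'S_m) : Prop :=
  is_partition m lambda /\
  forall i j : 'I_m, j = i.+1 :> nat ->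
    pi j < pi i -> nth 0 lambda j < nth 0 lambda i.

(* dp pi lives in 'S_l with l the number of derangement points of pi, so
   dp(pi) = sigma includes the equality l = k along which dp pi is transported. *)
Definition setA n k (sigma : 'S_k) : set (seq nat * 'S_n) :=
  [set x | standard_labeled_partition x.1 x.2 /\
           exists E : #|derangement_points x.2| = k,
             cast_perm E (dp x.2) = sigma]%classic.

Definition setB n k (sigma : 'S_k) : set (seq nat * seq nat) :=
  [set y | [/\ is_partition k y.1, is_partition (n - k) y.2 &
               standard_labeled_partition y.1 sigma]]%classic.

Definition phi n (x : seq nat * 'S_n) : seq nat * seq nat :=
  ([seq nth 0 x.1 (val j) | j <- enum (derangement_points x.2)],
   [seq nth 0 x.1 (val i) | i <- enum (fixed_points x.2)]).

(* Main.v *)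
(* A permutation pi with dp(pi) = sigma is the same thing as a merge of the index
   sets of beta and gamma into {0, ..., n-1}.  Standardness of (mu, pi) forces
   this merge to follow a linear order depending only on beta, gamma and sigma:
   larger parts come first and, among equal parts, the deficiencies of sigma
   (sigma a < a) come first, then the fixed points, then the excedances
   (a < sigma a).  Since a linear order on n elements has exactly one increasing
   bijection onto {0, ..., n-1}, (mu, pi) can be recovered uniquely. *)
Require Import Defs.
From mathcomp Require Import classical_sets functions.
From mathcomp Require Import all_boot all_fingroup.
From mathcomp Require Import zify.

Set Implicit Arguments.
Unset Strict Implicit.
Unset Printing Implicit Defensive.

(** * Standardness on constant blocks of a partition *)

Lemma partition_nth_geq m (s : seq nat) i j :
  is_partition m s -> i <= j -> nth 0 s j <= nth 0 s i.
Proof.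
move=> /andP[_ sorted_s] le_ij; have [lt_j|ge_j] := ltnP j (size s).
  have geq_trans : transitive geq by move=> x y z /= le_xy /leq_trans; apply.
  apply: (sorted_leq_nth geq_trans leqnn 0 sorted_s) => //.
  exact: leq_ltn_trans lt_j.
by rewrite nth_default.
Qed.

(** Between [i] and [j] the partition is constant, so standardness forbids descents and [pi] gains
    at least 1 at every step. Equivalently, the excess [pi i - i], as an integer, is nondecreasing
    on a constant block: deficiencies come before excedances. *)
Lemma standard_gap m (s : seq nat) (pi : 'S_m) (i j : 'I_m) :
    standard_labeled_partition s pi -> i <= j -> nth 0 s i = nth 0 s j ->
  pi i + (j - i) <= pi j.
Proof.
move=> [part_s std_s].
move: {2}(j - i) (leqnn (j - i)) => d.
elim: d i => [|d IHd] i le_d le_ij eq_s.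
  by have /val_inj-> : i = j :> nat by [lia]; rewrite subnn addn0.
have [/val_inj->|ne_ij] := eqVneq (i : nat) j; first by rewrite subnn addn0.
have lt_im : i.+1 < m by have := ltn_ord j; lia.
pose i' := Ordinal lt_im.
have eq_i' : nth 0 s i' = nth 0 s i.
  apply/eqP; rewrite eqn_leq (partition_nth_geq part_s) ?leqnSn // eq_s.
  by apply: (partition_nth_geq part_s) => /=; lia.
have lt_pi : pi i < pi i'.
  have := std_s i i' erefl; rewrite eq_i' ltnn.
  by case: ltngtP => // [_ /(_ isT)//|/val_inj/perm_inj/(congr1 val) /=]; lia.
have := IHd i'; rewrite eq_i' /=; lia.
Qed.

(** Replaces the condition on adjacent indices by one on all pairs in a constant block, a form that
    passes to subwords and merges. *)
Lemma standard_ltnP m (s : seq nat) (pi : 'S_m) :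
  standard_labeled_partition s pi <->
  is_partition m s /\
  forall i j : 'I_m, i < j -> nth 0 s i = nth 0 s j -> pi i < pi j.
Proof.
split=> [std_s|[part_s std_s]].
  split=> [|i j lt_ij eq_s]; first by case: std_s.
  have := standard_gap std_s (ltnW lt_ij) eq_s; lia.
split=> // i j ij lt_pi; have lt_ij : i < j by rewrite ij.
have := partition_nth_geq part_s (ltnW lt_ij).
rewrite leq_eqVlt => /predU1P[eq_s|//].
by have := std_s i j lt_ij (esym eq_s); lia.
Qed.

Lemma is_partition_map m (v : 'I_m -> nat) :
  (forall i j : 'I_m, i < j -> v j <= v i) ->
  is_partition m [seq v i | i <- enum 'I_m].
Proof.
move=> v_geq; rewrite /is_partition size_map size_enum_ord eqxx /=.
have := iota_ltn_sorted 0 m; rewrite -val_enum_ord !sorted_map.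
by apply: sub_sorted => i j; exact: v_geq.
Qed.

Lemma nth_map_enum_ord m (v : 'I_m -> nat) (i : 'I_m) :
  nth 0 [seq v j | j <- enum 'I_m] i = v i.
Proof. by rewrite (nth_map i) ?size_enum_ord // nth_ord_enum. Qed.

(** * Increasing maps and sorted enumerations *)

Lemma increasing_ltn k n (p : 'I_k -> 'I_n) :
  {homo p : a b / a < b} -> forall a b, (p a < p b) = (a < b).
Proof.
move=> p_lt a b; case: (ltngtP a b) => [/p_lt //|/p_lt|/val_inj->]; lia.
Qed.

Lemma sorted_enum_ord n (A : {set 'I_n}) : sorted (relpre val ltn) (enum A).
Proof.
rewrite /enum_mem; apply: sorted_filter => [x y z /=|]; first exact: ltn_trans.
by rewrite -enumT -sorted_map val_enum_ord iota_ltn_sorted.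
Qed.

Lemma enum_val_increasing n (A : {set 'I_n}) :
  {homo @enum_val _ (mem A) : a b / a < b}.
Proof.
move=> a b lt_ab; have x0 : 'I_n := enum_val a; rewrite !(enum_val_nth x0).
have ltn_tr : transitive (relpre (val : 'I_n -> nat) ltn).
  by move=> x y z /=; apply: ltn_trans.
apply: (sorted_ltn_nth ltn_tr _ (sorted_enum_ord A)) => //; by rewrite inE -cardE.
Qed.

(** Both lists are strictly increasing and have the same elements. *)
Lemma enum_increasing k n (p : 'I_k -> 'I_n) (A : {set 'I_n}) :
  {homo p : a b / a < b} -> (forall i, (i \in A) = (i \in codom p)) ->
  enum A = [seq p a | a <- enum 'I_k].
Proof.
move=> p_lt A_p; apply: (@irr_sorted_eq _ (relpre val ltn)) => [x y z /=|x /=|||i].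
- exact: ltn_trans.
- exact: ltnn.
- exact: sorted_enum_ord.
- have := iota_ltn_sorted 0 k; rewrite -val_enum_ord !sorted_map.
  by apply: sub_sorted => a b; exact: p_lt.
- by rewrite mem_enum A_p.
Qed.

(** * Finite linear orders and their bijections onto an initial segment *)

(** Reindexing along [f] turns the count into that of the [j < f x]. Hence [f] can be recovered from
    the order it induces on [T]. *)
Lemma card_lower_bij (T : finType) n (f : T -> 'I_n) :
  bijective f -> forall x, #|[pred y | f y < f x]| = f x.
Proof.
move=> f_bij x.
rewrite -sum1_card.
rewrite -(reindex f (P := fun j : 'I_n => j < f x) (F := fun=> 1)) /=.
  rewrite -(big_ord_widen n (fun=> 1)); last exact: ltnW.
  by rewrite sum1_card card_ord.
exact: onW_bij.
Qed.

Lemma ord_bij_unique (T : finType) n (f g : T -> 'I_n) :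
  bijective f -> bijective g ->
  (forall x y, (f x < f y) = (g x < g y)) -> f =1 g.
Proof.
move=> f_bij g_bij eq_fg x; apply/val_inj.
rewrite /= -(card_lower_bij f_bij) -(card_lower_bij g_bij).
by apply: eq_card => y; rewrite !inE eq_fg.
Qed.

(** The bijection sends [x] to its rank, the number of elements below it; rank is strictly monotone
    by transitivity, and injective by totality. *)
Lemma ord_bij_exists (T : finType) n (r : rel T) :
    #|T| = n -> irreflexive r -> transitive r ->
    (forall x y, x != y -> r x y || r y x) ->
  exists2 f : T -> 'I_n, bijective f & forall x y, (f x < f y) = r x y.
Proof.
move=> card_T r_irr r_tr r_tot.
pose rank x := #|[pred y | r y x]|.
have rank_mono x y : r x y -> rank x < rank y.
  move=> r_xy; apply: proper_card; apply/properP; split.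
    by apply/subsetP=> z; rewrite !inE => /r_tr; apply.
  by exists x; rewrite !inE ?r_irr.
have rank_ltn x y : (rank x < rank y) = r x y.
  apply/idP/idP => [lt_xy|/rank_mono//].
  have ne_xy : x != y by apply: contraTneq lt_xy => ->; rewrite ltnn.
  by case/orP: (r_tot _ _ ne_xy) => // /rank_mono; rewrite ltnNge ltnW.
have rank_lt x : rank x < n.
  rewrite -card_T; apply: proper_card; apply/properP.
  by split; [exact/subsetP | exists x; rewrite ?inE ?r_irr].
exists (fun x => Ordinal (rank_lt x)) => //.
apply: inj_card_bij; last by rewrite card_ord card_T.
move=> x y /(congr1 val) /= eq_rank; apply/eqP.
by apply: contraT => /r_tot; rewrite -!rank_ltn eq_rank ltnn.
Qed.

Lemma perm_order_inj k (s t : 'S_k) :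
  (forall a b, (s a < s b) = (t a < t b)) -> s = t.
Proof.
move=> eq_st; apply/permP; apply: ord_bij_unique eq_st; apply: injF_bij;
exact: perm_inj.
Qed.

(** * Splitting a permutation into its derangement points and fixed points *)

(* pos (inl a) and pos (inr f) are the a-th derangement point and the f-th fixed
   point of pi, provided that sigma is a derangement. *)
Definition decomposes n k l (pi : 'S_n) (sigma : 'S_k)
    (pos : 'I_k + 'I_l -> 'I_n) : Prop :=
  [/\ bijective pos,
      {homo (fun a => pos (inl a)) : a b / a < b},
      {homo (fun f => pos (inr f)) : f g / f < g},
      forall a, pi (pos (inl a)) = pos (inl (sigma a)) &
      forall f, pi (pos (inr f)) = pos (inr f)].

Section Decomposition.
Variables (n k l : nat) (pi : 'S_n) (sigma : 'S_k).
Variable pos : 'I_k + 'I_l -> 'I_n.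
Hypothesis deranged_sigma : sigma \in derangements k.
Hypothesis dec : decomposes pi sigma pos.

(** Through the injection [pos], [pi] acts on left labels as [sigma], which moves each of them, and
    it fixes all right labels. *)
Lemma decomposes_derangement_points i :
  (i \in derangement_points pi) = (i \in codom (fun a => pos (inl a))).
Proof.
case: dec => pos_bij _ _ pi_l pi_r; have pos_inj := bij_inj pos_bij.
case: (pos_bij) => g _ gK; rewrite -[i]gK inE.
case: (g i) => [a|f].
  rewrite pi_l (inj_eq pos_inj) codom_f.
  by move: deranged_sigma; rewrite inE => /forallP/(_ a).
by rewrite pi_r eqxx; apply/esym/negbTE/codomP => -[b /pos_inj].
Qed.

Lemma decomposes_fixed_points i :
  (i \in fixed_points pi) = (i \in codom (fun f => pos (inr f))).
Proof.
case: dec => pos_bij _ _ pi_l pi_r; have pos_inj := bij_inj pos_bij.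
rewrite inE -[_ == _]negbK.
have := decomposes_derangement_points i; rewrite inE => ->.
case: (pos_bij) => g _ gK; rewrite -[i]gK.
case: (g i) => [a|f]; rewrite codom_f.
  by apply/esym/negbTE/codomP => -[f /pos_inj].
by apply/codomP => -[b /pos_inj].
Qed.

Lemma decomposes_phi mu :
  phi (mu, pi) = ([seq nth 0 mu (pos (inl a)) | a <- enum 'I_k],
                  [seq nth 0 mu (pos (inr f)) | f <- enum 'I_l]).
Proof.
case: dec => _ pos_l pos_r _ _; rewrite /phi /=.
rewrite (enum_increasing pos_l decomposes_derangement_points).
by rewrite (enum_increasing pos_r decomposes_fixed_points) -!map_comp.
Qed.

(** A permutation is determined by how it orders its values. Since [pos] is increasing on left
    labels, comparing values of [pi] at derangement points amounts to comparing values of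
    [sigma]. *)
Lemma decomposes_dp :
  exists E : #|derangement_points pi| = k, cast_perm E (dp pi) = sigma.
Proof.
case: dec => _ pos_l _ pi_l _.
have enum_D := enum_increasing pos_l decomposes_derangement_points.
have E : #|derangement_points pi| = k by rewrite cardE enum_D size_map size_enum_ord.
exists E; apply: perm_order_inj => a b.
have enum_val_D c : enum_val (cast_ord (esym E) c) = pos (inl c).
  rewrite (enum_val_nth (pos (inl c))) enum_D (nth_map c) ?size_enum_ord //=.
  by rewrite nth_ord_enum.
rewrite !cast_permE /= std_ltn /derangement_word !enum_val_D !pi_l.
exact: (increasing_ltn pos_l).
Qed.

End Decomposition.

Lemma dp_decomposes n k (pi : 'S_n) (sigma : 'S_k) :
    (exists E : #|derangement_points pi| = k, cast_perm E (dp pi) = sigma) ->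
  exists pos : 'I_k + 'I_(n - k) -> 'I_n, decomposes pi sigma pos.
Proof.
case=> E; subst k; rewrite cast_perm_id => <- {sigma}.
have FD : fixed_points pi = ~: derangement_points pi.
  by apply/setP => i; rewrite !inE negbK.
have card_F : n - #|derangement_points pi| = #|fixed_points pi|.
  by rewrite FD [RHS]cardsCs finset.setCK card_ord.
pose pos x := match x with
  | inl a => @enum_val _ (mem (derangement_points pi)) a
  | inr f => @enum_val _ (mem (fixed_points pi)) (cast_ord card_F f)
  end.
have pos_l a : pos (inl a) \in derangement_points pi by exact: enum_valP.
have pos_r f : pos (inr f) \in fixed_points pi by exact: enum_valP.
have pi_D i : i \in derangement_points pi -> pi i \in derangement_points pi.
  by rewrite !inE (inj_eq perm_inj).
exists pos; split.
- apply: inj_card_bij; last first.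
    rewrite card_sum !card_ord subnKC // -[X in _ <= X](card_ord n).
    exact: max_card.
  have pos_neq a f : pos (inl a) <> pos (inr f).
    move=> eq_af; have := pos_l a; rewrite eq_af.
    by have := pos_r f; rewrite FD inE => /negP.
  move=> [a|f] [b|g] //= eq_pos.
  + by rewrite (enum_val_inj eq_pos).
  + by case: (pos_neq _ _ eq_pos).
  + by case: (pos_neq _ _ (esym eq_pos)).
  + by rewrite (cast_ord_inj (enum_val_inj eq_pos)).
- exact: enum_val_increasing.
- by move=> f g lt_fg; apply: enum_val_increasing.
(* [pi] permutes its derangement points, and [tau] is this action read on their ranks. As [enum_val]
   is increasing, [tau] orders its values as the derangement word does, so it is the
   standardization. *)
- pose tau a := enum_rank_in (pos_l a) (pi (pos (inl a))).
  have tauE a : pos (inl (tau a)) = pi (pos (inl a)).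
    by rewrite /= enum_rankK_in // pi_D.
  suff tau_dp : tau =1 dp pi by move=> a; rewrite -tauE tau_dp.
  apply: (@ord_bij_unique _ _ tau (dp pi)) => [||b c].
  + apply: injF_bij => b c eq_bc; have := tauE b.
    by rewrite eq_bc tauE => /perm_inj/enum_val_inj/esym.
  + by apply: injF_bij; exact: perm_inj.
  + rewrite std_ltn /derangement_word -(increasing_ltn (@enum_val_increasing _ _)).
    by have := tauE b; have := tauE c => /= -> ->.
- by move=> f; have := pos_r f; rewrite inE => /eqP.
Qed.

(** * The merge order on the parts of [beta] and [gamma] *)

Lemma derangements_neq k (sigma : 'S_k) :
  sigma \in derangements k -> forall a, sigma a != a :> nat.
Proof. by rewrite inE => /forallP sigma_neq a; rewrite val_eqE. Qed.

Definition merged_value k l (beta gamma : seq nat) (x : 'I_k + 'I_l) : nat :=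
  match x with inl a => nth 0 beta a | inr f => nth 0 gamma f end.

(** Labels on the same side are compared by index alone; this agrees with decreasing values, and
    with the tie-breaking rule by [standard_gap]. *)
Definition merge_lt k l (sigma : 'S_k) (beta gamma : seq nat) :
    rel ('I_k + 'I_l) := fun x y =>
  match x, y with
  | inl a, inl b => a < b
  | inr f, inr g => f < g
  | inl a, inr f => (nth 0 gamma f < nth 0 beta a) ||
                    (nth 0 gamma f == nth 0 beta a) && (sigma a < a)
  | inr f, inl a => (nth 0 beta a < nth 0 gamma f) ||
                    (nth 0 beta a == nth 0 gamma f) && (a < sigma a)
  end.

Section MergeOrder.
Variables (k l : nat) (sigma : 'S_k) (beta gamma : seq nat).
Let lt := @merge_lt k l sigma beta gamma.

Lemma merge_lt_irr : irreflexive lt.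
Proof. by move=> [a|f] /=; rewrite ltnn. Qed.

(** A tie between a part of [beta] and a part of [gamma] is always broken, because [sigma a] differs
    from [a]. *)
Lemma merge_lt_total :
  sigma \in derangements k -> forall x y, x != y -> lt x y || lt y x.
Proof.
move=> deranged_sigma x y.
case: x y => [a|f] [b|g] /=.
- by case: ltngtP => // /val_inj->; rewrite eqxx.
- by have := derangements_neq deranged_sigma a; lia.
- by have := derangements_neq deranged_sigma b; lia.
- by case: ltngtP => // /val_inj->; rewrite eqxx.
Qed.

Hypothesis std_beta : standard_labeled_partition beta sigma.
Hypothesis part_gamma : is_partition l gamma.

(** In the mixed cases a failure would force all three values to be equal. With two left labels,
    [standard_gap] then rules it out: in a constant block, what precedes a deficiency is a
    deficiency and what follows an excedance is an excedance. *)
Lemma merge_lt_trans : transitive lt.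
Proof.
have part_beta : is_partition k beta by case: std_beta.
move=> [b|g] [a|f] [c|h] /=; try exact: ltn_trans.
- have := partition_nth_geq part_beta (i := a) (j := b).
  by have := @standard_gap _ _ _ a b std_beta; lia.
- have := partition_nth_geq part_beta (i := b) (j := c).
  by have := @standard_gap _ _ _ b c std_beta; lia.
- by have := partition_nth_geq part_gamma (i := h) (j := f); lia.
- have := partition_nth_geq part_beta (i := c) (j := a).
  by have := @standard_gap _ _ _ c a std_beta; lia.
- by have := partition_nth_geq part_gamma (i := g) (j := h); lia.
- by have := partition_nth_geq part_gamma (i := f) (j := g); lia.
Qed.

Lemma merge_lt_value x y :
  lt x y -> merged_value beta gamma y <= merged_value beta gamma x.
Proof.
have part_beta : is_partition k beta by case: std_beta.
case: x y => [a|f] [b|g] /=; try lia.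
- by move/ltnW; exact: (partition_nth_geq part_beta).
- by move/ltnW; exact: (partition_nth_geq part_gamma).
Qed.

End MergeOrder.

(** * Standard labeled partitions follow the merge order *)

Section Standard.
Variables (n k l : nat) (mu : seq nat) (pi : 'S_n) (sigma : 'S_k).
Variable pos : 'I_k + 'I_l -> 'I_n.
Hypothesis deranged_sigma : sigma \in derangements k.
Hypothesis std_mu : standard_labeled_partition mu pi.
Hypothesis dec : decomposes pi sigma pos.
Let beta := (phi (mu, pi)).1.
Let gamma := (phi (mu, pi)).2.

Lemma phi_value x : merged_value beta gamma x = nth 0 mu (pos x).
Proof.
by rewrite /beta /gamma (decomposes_phi deranged_sigma dec); case: x => c /=;
  rewrite nth_map_enum_ord.
Qed.

Let mu_geq i j : i <= j -> nth 0 mu j <= nth 0 mu i.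
Proof. by case: std_mu => part_mu _; exact: (partition_nth_geq part_mu). Qed.

Let mu_pi_ltn (i j : 'I_n) : i < j -> nth 0 mu i = nth 0 mu j -> pi i < pi j.
Proof. by case/standard_ltnP: std_mu => _; apply. Qed.

Lemma phi_fixed_partition : is_partition l gamma.
Proof.
rewrite /gamma (decomposes_phi deranged_sigma dec).
case: dec => _ _ pos_r _ _; apply: is_partition_map => f g /pos_r lt_fg.
exact/mu_geq/ltnW.
Qed.

(** The all-pairs form of standardness restricts to the derangement points, where [pos] is
    increasing and turns [pi] into [sigma]. *)
Lemma phi_standard : standard_labeled_partition beta sigma.
Proof.
case: dec => _ pos_l _ pi_l _; apply/standard_ltnP; split.
  rewrite /beta (decomposes_phi deranged_sigma dec).
  apply: is_partition_map => a b /pos_l lt_ab; exact/mu_geq/ltnW.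
move=> a b lt_ab; have := phi_value (inl a); have := phi_value (inl b).
rewrite /= => -> -> eq_mu.
by rewrite -(increasing_ltn pos_l) -!pi_l mu_pi_ltn // pos_l.
Qed.

(* An excedance before a fixed point in the same constant block of mu would be
   carried by pi to a later one, still before that fixed point, and so on. *)
Lemma no_excedance_before a f :
    pos (inl a) < pos (inr f) ->
    nth 0 mu (pos (inl a)) = nth 0 mu (pos (inr f)) ->
  sigma a <= a.
Proof.
case: dec => _ pos_l _ pi_l pi_r.
move: {2}(k - a) (leqnn (k - a)) => d; elim: d a => [|d IHd] a le_d lt_af eq_af.
  by have := ltn_ord a; lia.
rewrite leqNgt; apply/negP => exc_a.
have lt_sf : pos (inl (sigma a)) < pos (inr f) by rewrite -pi_l -pi_r mu_pi_ltn.
have eq_sf : nth 0 mu (pos (inl (sigma a))) = nth 0 mu (pos (inr f)).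
  apply/eqP; rewrite eqn_leq (mu_geq (ltnW lt_sf)) -eq_af andbT.
  exact/mu_geq/ltnW/pos_l.
have lt_ss : sigma a < sigma (sigma a).
  rewrite -(increasing_ltn pos_l) -(pi_l a) -pi_l mu_pi_ltn ?pos_l //.
  by rewrite eq_sf.
have le_sd : k - sigma a <= d by lia.
by have := IHd _ le_sd lt_sf eq_sf; lia.
Qed.

(** Mirror image of the previous argument: [pi] would carry such a deficiency to an earlier one,
    still after the fixed point, and the descent on [a] cannot go on. *)
Lemma no_deficiency_after a f :
    pos (inr f) < pos (inl a) ->
    nth 0 mu (pos (inr f)) = nth 0 mu (pos (inl a)) ->
  a <= sigma a.
Proof.
case: dec => _ pos_l _ pi_l pi_r.
move: {2}(nat_of_ord a) (leqnn a) => d; elim: d a => [|d IHd] a le_d lt_fa eq_fa.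
  by lia.
rewrite leqNgt; apply/negP => def_a.
have lt_fs : pos (inr f) < pos (inl (sigma a)) by rewrite -pi_l -pi_r mu_pi_ltn.
have eq_fs : nth 0 mu (pos (inr f)) = nth 0 mu (pos (inl (sigma a))).
  apply/eqP; rewrite eqn_leq (mu_geq (ltnW lt_fs)) eq_fa andbT.
  exact/mu_geq/ltnW/pos_l.
have lt_ss : sigma (sigma a) < sigma a.
  rewrite -(increasing_ltn pos_l) -(pi_l a) -pi_l mu_pi_ltn ?pos_l //.
  by rewrite -eq_fs.
have le_sd : sigma a <= d by lia.
by have := IHd _ le_sd lt_fs eq_fs; lia.
Qed.

(** The right-hand side involves only [beta], [gamma] and [sigma], so these determine [pos]. One
    implication is enough: positions are totally ordered and [merge_lt] is a strict order. *)
Lemma pos_merge_lt x y : (pos x < pos y) = merge_lt sigma beta gamma x y.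
Proof.
case: dec => pos_bij pos_l pos_r _ _.
have pos_lt u v : pos u < pos v -> merge_lt sigma beta gamma u v.
  move=> lt_uv; have := mu_geq (ltnW lt_uv); rewrite -!phi_value.
  case: u v lt_uv => [a|f] [b|g] /=.
  - by rewrite (increasing_ltn pos_l).
  (* On a tie [sigma a <= a], and this is strict because [sigma] is a derangement. *)
  - move=> lt_ag le_ga; have := no_excedance_before lt_ag; rewrite -!phi_value /=.
    by have := derangements_neq deranged_sigma a; lia.
  - move=> lt_fb le_bf; have := no_deficiency_after lt_fb; rewrite -!phi_value /=.
    by have := derangements_neq deranged_sigma b; lia.
  - by rewrite (increasing_ltn pos_r).
apply/idP/idP => [/pos_lt //|lt_xy].
case: ltngtP => // [/pos_lt lt_yx|/val_inj/(bij_inj pos_bij) eq_xy].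
  have := merge_lt_trans phi_standard phi_fixed_partition lt_xy lt_yx.
  by rewrite merge_lt_irr.
by move: lt_xy; rewrite eq_xy merge_lt_irr.
Qed.

End Standard.

(** * Sizes and the bijection *)

Lemma sumn_phi n (mu : seq nat) (pi : 'S_n) :
  size mu = n ->
  sumn mu = sumn (phi (mu, pi)).1 + sumn (phi (mu, pi)).2.
Proof.
move=> size_mu; rewrite !sumnE /phi /= !big_map !big_enum /=.
rewrite (big_nth 0) size_mu big_mkord (bigID [pred i | i \in derangement_points pi]).
by congr (_ + _); apply: eq_bigl => i; rewrite !inE ?negbK.
Qed.

Theorem theorem2p2 (k n : nat) (hkn : k <= n) (sigma : 'S_k)
    (hsigma : sigma \in derangements k) :
  set_bij (setA (n := n) sigma) (setB n sigma) (phi (n := n)) /\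
  (forall (mu : seq nat) (pi : 'S_n), setA sigma (mu, pi) ->
     sumn mu = sumn (phi (mu, pi)).1 + sumn (phi (mu, pi)).2).
Proof.
split; last by move=> mu pi [] [/andP[/eqP size_mu _] _] _; exact: sumn_phi.
split.
- move=> [mu pi] [std_mu /dp_decomposes[pos dec]].
  have std_beta := phi_standard hsigma std_mu dec.
  by split=> //; [case: std_beta | exact: phi_fixed_partition hsigma std_mu dec].
- move=> [mu pi] [mu' pi'] /set_mem[std_mu /dp_decomposes[pos dec]].
  move=> /set_mem[std_mu' /dp_decomposes[pos' dec']] eq_phi.
  rewrite /= in std_mu dec std_mu' dec'.
  have [pos_bij pos_l pos_r pi_l pi_r] := dec.
  have [pos_bij' _ _ pi_l' pi_r'] := dec'.
  (* Injectivity: both position maps induce the merge order of the common image, hence coincide.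
     Then [mu] is read off from [beta] and [gamma] at these positions, and [pi] from [sigma]. *)
  have eq_pos : pos =1 pos'.
    apply: ord_bij_unique => // x y.
    rewrite (pos_merge_lt hsigma std_mu dec) (pos_merge_lt hsigma std_mu' dec').
    by rewrite eq_phi.
  case: (pos_bij) => g _ gK.
  have [/andP[/eqP size_mu _] _] := std_mu.
  have [/andP[/eqP size_mu' _] _] := std_mu'.
  congr (_, _).
    apply: (@eq_from_nth _ 0) => [|i]; first by rewrite size_mu.
    rewrite size_mu => lt_in; rewrite -[i]/(val (Ordinal lt_in)) -[Ordinal _]gK.
    rewrite -(phi_value mu hsigma dec) eq_phi (phi_value mu' hsigma dec').
    by rewrite eq_pos.
  apply/permP => i; rewrite -[i]gK; case: (g i) => [a|f].
    by rewrite pi_l !eq_pos pi_l'.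
  by rewrite pi_r !eq_pos pi_r'.
- move=> [beta gamma] [/= part_beta part_gamma std_beta].
  have card_T : #|{: 'I_k + 'I_(n - k)}| = n by rewrite card_sum !card_ord subnKC.
  (* Surjectivity: the labels are laid out along the merge order, and [pi] is defined as the
     conjugate by [pos] of [img], which is [sigma] on left labels and the identity on right ones. *)
  have [pos pos_bij pos_lt] := ord_bij_exists card_T
    (@merge_lt_irr k (n - k) sigma beta gamma)
    (merge_lt_trans std_beta part_gamma) (merge_lt_total beta gamma hsigma).
  have [g posK gK] := pos_bij.
  pose img x : 'I_k + 'I_(n - k) :=
    match x with inl a => inl (sigma a) | inr f => inr f end.
  have img_inj : injective img.
    by move=> [a|f] [b|h] //= [/perm_inj->].
  have pi_inj : injective (fun i => pos (img (g i))).
    by move=> i j /(bij_inj pos_bij)/img_inj/(can_inj gK).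
  pose pi : 'S_n := perm pi_inj.
  have pi_pos x : pi (pos x) = pos (img x) by rewrite permE posK.
  pose mu := [seq merged_value beta gamma (g i) | i <- enum 'I_n].
  have mu_pos x : nth 0 mu (pos x) = merged_value beta gamma x.
    by rewrite nth_map_enum_ord posK.
  have dec : decomposes pi sigma pos.
    by split=> // [a b|f h|a]; rewrite ?pos_lt ?pi_pos.
  have std_mu : standard_labeled_partition mu pi.
    apply/standard_ltnP; split.
      apply: is_partition_map => i j; rewrite -{1}[i]gK -{1}[j]gK pos_lt.
      exact: merge_lt_value.
    move=> i j; rewrite -[i]gK -[j]gK !mu_pos !pi_pos.
    (* Two left labels are handled by standardness of [beta]. In a tie, a left label before a right
       one is a deficiency, so [pi] moves it further left; one after a right label is an excedance
       and moves further right. Either way the order with the fixed point is kept. *)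
    case: (g i) (g j) => [a|f] [b|h] //= lt_pos eq_value.
    + move: lt_pos eq_value; rewrite !pos_lt /=.
      by case/standard_ltnP: std_beta => _; apply.
    + apply: (ltn_trans _ lt_pos); rewrite pos_lt /=.
      by move: lt_pos; rewrite pos_lt /=; lia.
    + apply: (ltn_trans lt_pos); rewrite pos_lt /=.
      by move: lt_pos; rewrite pos_lt /=; lia.
  suff <- : phi (mu, pi) = (beta, gamma).
    apply: classical_sets.imageP; split=> //; exact: decomposes_dp hsigma dec.
  rewrite (decomposes_phi hsigma dec).
  have seq_of m (s : seq nat) (v : 'I_m -> nat) :
      is_partition m s -> (forall i : 'I_m, v i = nth 0 s i) ->
      [seq v i | i <- enum 'I_m] = s.
    move=> /andP[/eqP size_s _] v_s; apply: (@eq_from_nth _ 0).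
      by rewrite size_map size_enum_ord.
    rewrite size_map size_enum_ord => i lt_im.
    by rewrite -[i]/(val (Ordinal lt_im)) nth_map_enum_ord.
  by congr (_, _); apply: seq_of => // i; rewrite mu_pos.
Qed.
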